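(* Let $W\in\mathbb{R}^{n\times n}$ be an invertible, normalized diagonally dominant matrix, and let $A=(\operatorname{diag}(W))^{-1}$ and $B=I_{n\times n}-(\operatorname{diag}(W))^{-1}W$. Then there exist constants $c_1>0$ and $0<c_2<1$ (depending only on $W$) such that, considering only fair runs, the algorithm Async-SS-Iterative $\epsilon$-always converges with $$\epsilon(\Delta t,\delta,\mathcal{C})=\delta c_1+(c_2)^{\Delta t}z ,$$ where $\Delta t$ counts the asynchronous rounds of the fair run and $z=\max_i|O_{p_i}(0)-\mathbf{u}_i|$. Explicitly: for every $\delta\ge 0$, every $\mathbf{v}\in\mathbb{R}^n$ with $\mathbf{u}$ the solution of $\mathbf{u}=A\mathbf{v}+B\mathbf{u}$, every initial output vector $O(0)\in\mathbb{R}^n$, every sequence of inputs $I(0),I(1),I(2),\dots$ in $\mathbb{R}^n$ that is $\delta$-bounded around $\mathbf{v}$, and every fair run with these data, for every $\Delta t\ge 1$ the output vector $O(r)$ at the atomic step $r$ that ends round $\Delta t$ satisfies $$\|O(r)-\mathbf{u}\|_\infty\le \delta c_1+(c_2)^{\Delta t}z .$$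
   Context: A matrix $M\in\mathbb{R}^{n\times n}$ is diagonally dominant if $|M_{ii}|>\sum_{j\neq i}|M_{ij}|$ for every $i$; it is normalized diagonally dominant if in addition $|M_{ii}|\ge 1$ for every $i$. Here $\operatorname{diag}(W)$ is the diagonal matrix with the same diagonal as $W$, and $\|\mathbf{x}\|_\infty=\max_i|\mathbf{x}_i|$. A sequence of vectors is $\delta$-bounded around $\mathbf{v}$ if each of its members is within $\|\cdot\|_\infty$-distance $\delta$ of $\mathbf{v}$. Async-SS-Iterative is an asynchronous shared-memory algorithm on nodes $p_1,\dots,p_n$: each node forever repeats a loop in which it writes its current output to its neighbours' registers and then recomputes its output as the weighted sum of its current input (weight $A_{ii}$) and the values read from its neighbours' registers (weights $B_{ij}$). Fair runs are modelled as follows. Atomic steps are numbered $r=1,2,3,\dots$, and $r=0$ denotes the initial configuration (regarded as round $0$). $I(r)\in\mathbb{R}^n$ and $O(r)\in\mathbb{R}^n$ are the input and output vectors at step $r$, with $i$-th coordinates $I_{p_i}(r)$ and $O_{p_i}(r)$. The steps $1,2,\dots$ are partitioned into consecutive finite intervals called rounds $1,2,3,\dots$, and in each round every node updates its output at least once (infinitely many rounds occur). If $p_i$ does not update its output at step $r$, then $O_{p_i}(r)=O_{p_i}(r-1)$. If $p_i$ updates its output at step $r$ belonging to round $k+1$ ($k\ge 0$), then $$O_{p_i}(r)=A_{ii}\,I_{p_i}(r')+\sum_{j\ne i}B_{ij}\,O_{p_j}(r'_j)$$ for some step indices $r'<r$ and $r'_j<r$ ($j\neq i$), all belonging to round $k$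 or round $k+1$. An algorithm $\epsilon$-always converges if, for every $\delta$-bounded input sequence around any $\mathbf{v}$ and every initial configuration $\mathcal{C}$, the output after $\Delta t$ rounds is within $\|\cdot\|_\infty$-distance $\epsilon(\Delta t,\delta,\mathcal{C})$ of the solution $\mathbf{u}$ for $\mathbf{v}$. *)

(* Defs.v *)
From HB Require Import structures.
From mathcomp Require Import all_boot all_order all_algebra.
From mathcomp Require Import all_classical all_reals all_analysis.
Set Implicit Arguments.
Unset Strict Implicit.
Unset Printing Implicit Defensive.
Import Order.TTheory GRing.Theory Num.Theory.
Import numFieldNormedType.Exports.
Local Open Scope ring_scope.

Definition diag_dominant (R : realType) (n : nat) (M : 'M[R]_n) : Prop :=
  forall i, \sum_(j | j != i) `|M i j| < `|M i i|.

Definition normalized_diag_dominant (R : realType) (n : nat) (M : 'M[R]_n) :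
    Prop :=
  diag_dominant M /\ forall i, 1 <= `|M i i|.

Definition diag_part (R : realType) (n : nat) (M : 'M[R]_n) : 'M[R]_n :=
  diag_mx (\row_i M i i).

(* On column vectors, the matrix norm of MathComp-Analysis is the maximum of
   the absolute values of the coordinates, so [`|x - y|] below is the
   sup-norm distance. *)
Definition delta_bounded (R : realType) (n : nat) (delta : R) (v : 'cV[R]_n)
    (I : nat -> 'cV[R]_n) : Prop :=
  forall r, `|I r - v| <= delta.

Definition is_solution (R : realType) (n : nat) (A B : 'M[R]_n)
    (v u : 'cV[R]_n) : Prop :=
  u = A *m v + B *m u.

(* [last k] is the atomic step that ends round [k]; round 0 is the initial
   configuration (step 0), so that [last 0 = 0]. *)
Definition in_round (last : nat -> nat) (k r : nat) : bool :=
  if k is k'.+1 then (last k' < r <= last k)%N else r == 0%N.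

(* [upd r] is the set of nodes that update their output at step [r]; it may
   contain several nodes, and [upd 0] is irrelevant.  The steps [r'] and
   [rj j] whose values are read may differ from one update to the next. *)
Definition fair_run (R : realType) (n : nat) (A B : 'M[R]_n)
    (I O : nat -> 'cV[R]_n) (last : nat -> nat) : Prop :=
  exists upd : nat -> {set 'I_n},
  [/\ last 0%N = 0%N /\ (forall k, (last k < last k.+1)%N),
      forall k i, exists2 r, in_round last k.+1 r & i \in upd r,
      forall r i, i \notin upd r.+1 -> O r.+1 i 0 = O r i 0
    & forall k r i, in_round last k.+1 r -> i \in upd r ->
      exists (r' : nat) (rj : 'I_n -> nat),
      [/\ (r' < r)%N && (in_round last k r' || in_round last k.+1 r'),
          forall j, j != i ->
            (rj j < r)%N &&
            (in_round last k (rj j) || in_round last k.+1 (rj j))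
        & O r i 0 = A i i * I r' i 0 + \sum_(j | j != i) B i j * O (rj j) j 0]].

(* An algorithm is given by its runs (inputs, outputs, ends of the rounds) and
   [sol v u] states that [u] is the solution for [v].  The configuration enters
   the bound [eps] through the initial outputs; [eps] may also refer to the
   solution [u], from which the initial error is measured. *)
Definition always_converges (R : realType) (n : nat)
    (run : (nat -> 'cV[R]_n) -> (nat -> 'cV[R]_n) -> (nat -> nat) -> Prop)
    (sol : 'cV[R]_n -> 'cV[R]_n -> Prop)
    (eps : nat -> R -> 'cV[R]_n -> 'cV[R]_n -> R) : Prop :=
  forall (delta : R) (v u : 'cV[R]_n) (I O : nat -> 'cV[R]_n)
         (last : nat -> nat),
  0 <= delta -> sol v u -> delta_bounded delta v I -> run I O last ->
  forall t, (0 < t)%N -> `|O (last t) - u| <= eps t delta (O 0%N) u.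

(* Main.v *)
Require Import Defs.
From mathcomp Require Import all_boot all_order all_algebra.
From mathcomp Require Import all_classical all_reals all_analysis.
From mathcomp Require Import ring.
Import Order.TTheory GRing.Theory Num.Theory.
Import numFieldNormedType.Exports.
Local Open Scope ring_scope.

(** Put b = c ^ 2 >= max_i \sum_(j != i) |B i j|, with b < 1, and
    C = 1 / (1 - b), so that delta + b (delta C) = delta C.  A value read in
    round k+1 may date from the end of round k-1, so one contraction by b is
    only guaranteed every two rounds: if the outputs are within
    delta C + c ^ (k-1) z of u throughout rounds k and k+1, then those computed
    in round k+1 are within delta C + c ^ (k+1) z.  Hence the rate c is a
    square root of b. *)

Lemma mx_norm_leP (R : realType) (n : nat) (x : 'cV[R]_n) (e : R) :
  0 <= e -> (forall i, `|x i 0| <= e) -> `|x| <= e.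
Proof.
move=> e0 xe; rewrite /Num.norm/= mx_normrE.
by apply: bigmax_le => // -[i j] _ /=; rewrite (ord1 j).
Qed.

Lemma coord_le_mx_norm (R : realType) (n : nat) (x : 'cV[R]_n) i :
  `|x i 0| <= `|x|.
Proof.
by rewrite [leRHS]/Num.norm/= mx_normrE; exact: (le_bigmax _ _ (i, ord0)).
Qed.

Lemma invmx_diag (F : fieldType) (n : nat) (d : 'rV[F]_n) :
  (forall i, d 0 i != 0) -> invmx (diag_mx d) = diag_mx (\row_i (d 0 i)^-1).
Proof.
move=> d0; set E := RHS.
have DE : diag_mx d *m E = 1%:M.
  by rewrite mulmx_diag -diag_const_mx; congr diag_mx; apply/rowP => i;
     rewrite !mxE mulfV.
by have [Du _] := mulmx1_unit DE; rewrite -[LHS]mulmx1 -DE mulKmx.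
Qed.

Lemma lt1_uniform_bound (R : realType) (T : finType) (f : T -> R) :
  (forall i, f i < 1) -> exists2 b, 0 < b < 1 & forall i, f i <= b.
Proof.
(* Starting the maximum at 1/2 keeps the bound positive even when no [f i] is, so that its square
   root can serve as a positive rate. *)
move=> f1; exists (\big[Num.max/2^-1]_i f i); last by move=> i; exact: le_bigmax.
apply/andP; split.
  by rewrite (lt_le_trans _ (bigmax_ge_id _ _ _ _))// invr_gt0.
by apply: bigmax_lt => //; rewrite invf_lt1 ?ltr1n.
Qed.

(** Error of one update: both sides carry the same weights, so the input error enters with factor at
    most 1 and the errors of the values read with total weight at most [b]. *)
Lemma weighted_sum_error (R : realType) (T : finType) (P : pred T) (i : T)
    (a delta b M y v : R) (w x u : T -> R) :
  0 <= M -> `|a| <= 1 -> \sum_(j | P j) `|w j| <= b ->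
  `|y - v| <= delta -> (forall j, P j -> `|x j - u j| <= M) ->
  `|a * y + \sum_(j | P j) w j * x j - (a * v + \sum_(j | P j) w j * u j)|
    <= delta + b * M.
Proof.
move=> M0 a1 wb yv xu.
rewrite opprD addrACA -mulrBr -sumrB (le_trans (ler_normD _ _))// lerD//.
  by rewrite normrM (le_trans _ yv)// ler_piMl.
rewrite (le_trans (ler_norm_sum _ _ _))//.
apply: (@le_trans _ _ ((\sum_(j | P j) `|w j|) * M)); last exact: ler_wpM2r.
rewrite mulr_suml; apply: ler_sum => j Pj.
by rewrite -mulrBr normrM ler_wpM2l ?xu.
Qed.

Section FairRun.
Context {R : realType} {n : nat} {A B : 'M[R]_n} {v u : 'cV[R]_n}.
Context {I O : nat -> 'cV[R]_n} {last : nat -> nat} {c delta : R}.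
Hypothesis c01 : 0 < c < 1.
Hypothesis A1 : forall i, `|A i i| <= 1.
Hypothesis Bc : forall i, \sum_(j | j != i) `|B i j| <= c ^+ 2.
Hypothesis uE : forall i,
  u i 0 = A i i * v i 0 + \sum_(j | j != i) B i j * u j 0.
Hypothesis delta0 : 0 <= delta.
Hypothesis Iv : delta_bounded delta v I.
Hypothesis run : fair_run A B I O last.

Let D (k : nat) : R := delta * (1 - c ^+ 2)^-1 + c ^+ k * `|O 0%N - u|.

Let c0 : 0 <= c. Proof. by case/andP: c01 => /ltW. Qed.

Let c1 : c <= 1. Proof. by case/andP: c01 => _ /ltW. Qed.

Let c21 : 0 < 1 - c ^+ 2.
Proof. by case/andP: c01 => c_gt0 c_lt1; rewrite subr_gt0 exprn_ilt1. Qed.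

Let D_ge0 k : 0 <= D k.
Proof. by rewrite addr_ge0 ?mulr_ge0 ?invr_ge0 ?exprn_ge0 // ltW. Qed.

Let D_anti k l : (k <= l)%N -> D l <= D k.
Proof. by move=> kl; rewrite lerD2l ler_wpM2r// ler_wiXn2l. Qed.

Let D_contract k : delta + c ^+ 2 * D k = D k.+2.
Proof.
rewrite /D !exprS expr0; field.
by move: (lt0r_neq0 c21); rewrite expr2.
Qed.

(** Two bounds are carried because a node keeps its old value until its first update in round k:
    during the round only the bound from the end of round k-1 is available, and the sharper one
    holds once every node has updated. In round 0 both are [D 0]. *)
Lemma fair_run_round k :
  (forall r i, in_round last k r -> `|O r i 0 - u i 0| <= D k.-1) /\
  (forall i, `|O (last k) i 0 - u i 0| <= D k).
Proof.
have [upd [[last0 lastS] upd_round keep compute]] := run.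
have err0 i : `|O 0%N i 0 - u i 0| <= D 0%N.
  have := coord_le_mx_norm _ _ (O 0%N - u) i; rewrite !mxE => /le_trans; apply.
  by rewrite /D expr0 mul1r lerDr mulr_ge0// invr_ge0 ltW.
elim: k => [|k [IHround IHend]].
  by split=> [r i /eqP->|i]; rewrite ?last0; exact: err0.
(* Strong induction on the step, with the end of round k as base. The second clause records that the
   sharper bound persists after an update of [i] at [s]. *)
have step r i : (last k <= r <= last k.+1)%N ->
    `|O r i 0 - u i 0| <= D k /\
    forall s, (last k < s <= r)%N -> i \in upd s -> `|O r i 0 - u i 0| <= D k.+1.
  elim/ltn_ind: r i => r IHr i /andP[]; rewrite leq_eqVlt => /orP[/eqP<- _|kr rk].
    split; first exact: IHend.
    by move=> s /andP[/leq_trans h /h]; rewrite ltnn.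
  have [ir|ir] := boolP (i \in upd r); last first.
    case: r => // r in IHr kr rk ir *.
    have [|Hk Hk1] := IHr r (leqnn _) i; first by rewrite -ltnS kr/= ltnW.
    rewrite keep//; split=> // s /andP[ks]; rewrite leq_eqVlt => /orP[/eqP->|sr].
      by rewrite (negbTE ir).
    by apply: Hk1; rewrite ks.
  suff E : `|O r i 0 - u i 0| <= D k.+1.
    by split=> //; apply: (le_trans E); exact: D_anti.
  have [r' [rj [_ rjP ->]]] := compute k r i (introT andP (conj kr rk)) ir.
  rewrite uE; apply: (@le_trans _ _ (delta + c ^+ 2 * D k.-1)).
    apply: weighted_sum_error => //.
      have := coord_le_mx_norm _ _ (I r' - v) i; rewrite !mxE => /le_trans; apply.
      exact: Iv.
    (* A value from round k has error at most [D k.-1] by [IHround]; an earlier one from round k+1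
       has error at most [D k <= D k.-1] by [IHr]. *)
    move=> j /rjP /andP[rjr /orP[/IHround//|/andP[krj rjk]]].
    have [|+ _] := IHr _ rjr j; first by rewrite (ltnW krj).
    by move/le_trans; apply; exact/D_anti/leq_pred.
  (* For k > 0 the two sides are equal; for k = 0 the predecessor truncates and the claim is
     [D 2 <= D 1]. *)
  by rewrite D_contract; apply: D_anti; case: (k).
split=> [r i /andP[kr rk]|i]; first by case: (step r i); rewrite ?(ltnW kr).
(* Fairness supplies an update of [i] in the round, which triggers the second clause of [step]. *)
have [s sk is_] := upd_round k i.
have [|_ /(_ s sk is_)//] := step (last k.+1) i.
by rewrite leqnn andbT ltnW.
Qed.

Lemma fair_run_error k : `|O (last k) - u| <= D k.
Proof.
by apply: mx_norm_leP => // i; rewrite !mxE; case: (fair_run_round k).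
Qed.

End FairRun.

Theorem theorem2 (R : realType) (n : nat) (W : 'M[R]_n) :
  W \in unitmx -> normalized_diag_dominant W ->
  let A := invmx (diag_part W) in
  let B := 1%:M - invmx (diag_part W) *m W in
  exists c1 c2 : R,
    [/\ 0 < c1, 0 < c2 < 1
      & always_converges (fair_run A B) (is_solution A B)
          (fun t delta O0 u => delta * c1 + c2 ^+ t * `|O0 - u|)].
Proof.
move=> _ [Wdom W1] A B.
have Wgt0 i : 0 < `|W i i| by exact: lt_le_trans (W1 i).
have W0 i : W i i != 0 by rewrite -normr_gt0.
have AE : A = diag_mx (\row_i (W i i)^-1).
  rewrite /A /diag_part invmx_diag => [|i]; last by rewrite mxE.
  by congr diag_mx; apply/rowP => i; rewrite !mxE.
have Aii i : A i i = (W i i)^-1 by rewrite AE !mxE eqxx.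
have BE i j : B i j = (i == j)%:R - (W i i)^-1 * W i j.
  by rewrite /B -/A AE mul_diag_mx !mxE.
(* The zero diagonal turns [B *m u] into the sum over [j != i] that the updates use. *)
have Bii i : B i i = 0 by rewrite BE eqxx mulVf ?subrr.
(* Row i of the diagonal dominance, divided by [|W i i|]. *)
have Boff i : \sum_(j | j != i) `|B i j| < 1.
  rewrite (eq_bigr (fun j => `|W i i|^-1 * `|W i j|)) => [|j ji]; last first.
    by rewrite BE eq_sym (negbTE ji) sub0r normrN normrM normfV.
  by rewrite -mulr_sumr mulrC ltr_pdivrMr ?mul1r.
have [b /andP[b0 b1] Bb] := lt1_uniform_bound _ _ _ Boff.
have sqb : Num.sqrt b ^+ 2 = b by rewrite sqr_sqrtr// ltW.
have c01 : 0 < Num.sqrt b < 1.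
  by rewrite sqrtr_gt0 b0/= -(@expr_lt1 _ 2) ?sqrtr_ge0// sqb.
exists (1 - Num.sqrt b ^+ 2)^-1, (Num.sqrt b); split=> //.
  by rewrite sqb invr_gt0 subr_gt0.
move=> delta v u I O last delta0 uE Iv run t _.
apply: (fair_run_error c01 _ _ _ delta0 Iv run).
(* The normalization [1 <= |W i i|] keeps the input error from being amplified. *)
- by move=> i; rewrite Aii normfV invf_le1.
- by move=> i; rewrite sqb.
- move=> i; rewrite [in LHS]uE mxE AE mul_diag_mx !mxE eqxx mulr1n.
  by rewrite (bigD1 i)//= Bii mul0r add0r.
Qed.
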